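(* With $C(n)$ and $C'(n)$ as defined in the context: (a) $$\sum_{n\ge1}C(n)q^n=\frac{2q^3(2-q+q^2)}{(1+q)(1+q^3)^2}\frac{(-q^2,-q^4;q^2)_\infty}{(q;q^2)_\infty^2}+\frac{q^2(1-q)}{(1+q)(1+q^3)^2}$$ $$=\frac{2q^3(2-q+q^2)}{(1+q)(1+q^3)^2}\frac{(-q^2,-q^4;q^2)_\infty}{(q;q^2)_\infty^2}+\sum_{n\ge0}(-1)^n(n+1)\big(n-nq+(n+1)q^2\big)q^{3n};$$ (b) $$\sum_{n\ge1}C'(n)q^n=\frac{q^2(1+q)}{(1-q)(1-q^3)^2}=\sum_{n\ge0}(n+1)\big(n+nq+(n+1)q^2\big)q^{3n}.$$
   Context: $(a;q)_\infty=\prod_{j\ge0}(1-aq^j)$, $(a_1,a_2;q)_\infty=(a_1;q)_\infty(a_2;q)_\infty$, $|q|<1$. A two-color partition is a partition whose parts are each colored blue or green (the same integer may occur in both colors). For a positive integer $n$, $C(n)$ is the number of two-color partitions of $n$ in which: the smallest part $s$ is odd and occurs at least once in each color, and every blue even part is at least $s+5$; no even integer occurs more than once in the same color (odd parts may repeat). $C_0(n)$ (resp. $C_1(n)$) is the number of partitions counted by $C(n)$ whose total number of even parts is even (resp. odd), and $C'(n)=C_0(n)-C_1(n)$. Equivalently, $\sum_{n\ge1}C(n)q^n=\sum_{n\ge0}q^{2(2n+1)}\frac{(-q^{2n+6};q^2)_\infty(-q^{2n+2};q^2)_\infty}{(q^{2n+1};q^2)_\infty^2}$ and $\sum_{n\ge1}C'(n)q^n=\sum_{n\ge0}q^{2(2n+1)}\frac{(q^{2n+6};q^2)_\infty(q^{2n+2};q^2)_\infty}{(q^{2n+1};q^2)_\infty^2}$.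 *)

(* Defs.v *)
From HB Require Import structures.
From mathcomp Require Import all_boot all_order all_algebra.
From mathcomp Require Export complex.
From mathcomp Require Import all_classical all_reals all_analysis.

Set Implicit Arguments.
Unset Strict Implicit.
Unset Printing Implicit Defensive.

Import Order.TTheory GRing.Theory Num.Theory.
Import numFieldNormedType.Exports.

Section TwoColorPartitions.
Local Open Scope nat_scope.
Variable n : nat.

(* m i is the number of parts equal to i; in a partition of n the parts and
   their multiplicities are at most n, so 'I_n.+1 loses nothing. *)
Definition multiplicities : predArgType := {ffun 'I_n.+1 -> 'I_n.+1}.

(* First component: blue parts; second component: green parts. *)
Definition two_coloring : predArgType := (multiplicities * multiplicities)%type.

Implicit Type p : two_coloring.

Definition blue p (i : 'I_n.+1) : nat := p.1 i.
Definition green p (i : 'I_n.+1) : nat := p.2 i.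

Definition is_two_color_partition p : bool :=
  [&& blue p ord0 == 0, green p ord0 == 0
    & \sum_(i < n.+1) i * (blue p i + green p i) == n].

Definition is_smallest_part p (s : 'I_n.+1) : bool :=
  (0 < blue p s + green p s)
  && [forall i : 'I_n.+1, (0 < blue p i + green p i) ==> (s <= i)].

Definition admissible p : bool :=
  [&& is_two_color_partition p,
      [exists s : 'I_n.+1,
         [&& is_smallest_part p s, odd s, 0 < blue p s, 0 < green p s
           & [forall i : 'I_n.+1,
                (~~ odd i && (0 < blue p i)) ==> (s + 5 <= i)]]]
    & [forall i : 'I_n.+1,
         ~~ odd i ==> (blue p i <= 1) && (green p i <= 1)]].

Definition nb_even_parts p : nat :=
  \sum_(i < n.+1 | ~~ odd i) (blue p i + green p i).

Definition C : nat := #|[set p | admissible p]|.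
Definition C0 : nat := #|[set p | admissible p & ~~ odd (nb_even_parts p)]|.
Definition C1 : nat := #|[set p | admissible p & odd (nb_even_parts p)]|.

Definition C' : int := (C0%:Z - C1%:Z)%R.

End TwoColorPartitions.

Section Analysis.
Local Open Scope ring_scope.
Local Open Scope classical_set_scope.
Variable R : realType.

(* The regular-module alias ^o carries the topology of the complex numbers. *)
Definition partial_sums (m : nat) (u : nat -> R[i]) : nat -> R[i]^o :=
  fun N => \sum_(m <= n < N) u n.

(* Sum over n >= m of u n, meaningful when the partial sums converge. *)
Definition infsum (m : nat) (u : nat -> R[i]) : R[i] :=
  limn (partial_sums m u).

Definition summable_from (m : nat) (u : nat -> R[i]) : Prop :=
  cvgn (partial_sums m u).

(* (a; q)_oo *)
Definition qpoch (a q : R[i]) : R[i] :=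
  limn ((fun N => \prod_(0 <= j < N) (1 - a * q ^+ j)) : nat -> R[i]^o).

(* (a1, a2; q)_oo *)
Definition qpoch2 (a1 a2 q : R[i]) : R[i] := qpoch a1 q * qpoch a2 q.

End Analysis.

(* Main.v *)
(**
Let [eps] be [1] for (a) and [-1] for (b), and count each partition with the
sign [eps ^+ number of even parts]. Sorted by the smallest part [2m + 1], the
partitions with parts at most [2M] have generating function
[\sum_(m < M) x^2 q^2 P_m] with [x = q^(2m)] and
[P_m = \prod_(m <= j < M) (1 - q^(2j+1))^-2 *
  \prod_(m <= j < M) (1 + eps q^(2j+2)) * \prod_(m+2 <= j < M) (1 + eps q^(2j+2))].
Gosper's algorithm gives a linear polynomial [X] in [x] with
[(1 + eps x) (1 + eps x q^4) X(x) - (1 - x q)^2 X(x q^2) = x^2 q^2],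
so the sum telescopes. As [M] grows it tends to the boundary term at [x = 1],
which carries the factor [1 + eps] and therefore vanishes in (b), minus [X(0)].

The counting series is compared with these truncations on boxes of bounded
parts and multiplicities: for each box, the error at [q] is at most the error
at [`|q|] with all signs positive, and the latter tends to [0] by monotonicity.
*)

Require Import Defs.
From mathcomp Require Import all_boot all_order all_algebra.
From mathcomp Require Import complex.
From mathcomp Require Import all_classical all_reals all_analysis.
From mathcomp Require Import zify ring lra.

Set Implicit Arguments.
Unset Strict Implicit.
Unset Printing Implicit Defensive.

Import Order.TTheory GRing.Theory Num.Theory.
Import numFieldNormedType.Exports.
Local Open Scope ring_scope.

(** * Two-color partitions with bounded parts and multiplicities *)

(** Part sizes and multiplicities are capped separately so that [K] can tend to infinity while [N]
    is fixed. For [N = K = n] this is [two_coloring n]. *)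
Definition box (N K : nat) : predArgType :=
  ({ffun 'I_N.+1 -> 'I_K.+1} * {ffun 'I_N.+1 -> 'I_K.+1})%type.

Section Boxes.
Local Open Scope nat_scope.

(** For a fixed smallest part [s] the conditions are imposed on one size [i] at a time, which makes
    the generating function a product over [i]. *)
Definition green_ok (s i k : nat) : bool :=
  if i < s then k == 0 else if i == s then 0 < k else odd i || (k <= 1).

Definition blue_ok (s i k : nat) : bool :=
  green_ok s i k && (~~ odd i && (0 < k) ==> (s + 5 <= i)).

Definition box_ok_at N K (s : nat) (p : box N K) : bool :=
  [forall i : 'I_N.+1, blue_ok s i (p.1 i)] &&
  [forall i : 'I_N.+1, green_ok s i (p.2 i)].

Definition box_ok N K (p : box N K) : bool :=
  [exists s : 'I_N.+1, odd s && box_ok_at s p].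

Definition weight N K (p : box N K) : nat :=
  \sum_(i < N.+1) i * (p.1 i + p.2 i).

Definition even_parts N K (p : box N K) : nat :=
  \sum_(i < N.+1 | ~~ odd i) (p.1 i + p.2 i).

Lemma admissible_box_ok n (p : box n n) :
  admissible p = box_ok p && (weight p == n).
Proof.
rewrite /admissible /is_two_color_partition /is_smallest_part /blue /green.
rewrite /weight.
apply/idP/idP.
- case/and3P => /and3P[/eqP b0 /eqP g0 ->] /existsP[s] /and5P[].
  move=> /andP[_ /forallP smin] os bs gs /forallP even5 /forallP le1.
  rewrite andbT; apply/existsP; exists s; rewrite os /=.
  suff ok (i : 'I_n.+1) : green_ok s i (p.1 i) && green_ok s i (p.2 i).
    apply/andP; split; apply/forallP => i; last by have /andP[] := ok i.
    by rewrite /blue_ok even5 andbT; have /andP[] := ok i.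
  have := smin i; have := le1 i; rewrite /green_ok.
  case: (ltngtP i s) => [lt_is _ | lt_si + _ | eq_is _ _] /=.
  + by case: (p.1 i : nat) => [|k]; case: (p.2 i : nat) => [|l].
  + by case: (odd i).
  + by rewrite (val_inj eq_is : i = s) bs gs.
- case/andP => /existsP[s /andP[os ok]] w.
  case/andP: ok => /forallP bl /forallP gr.
  (* An odd [s] is positive, so the size 0 lies below [s] and has multiplicity 0. *)
  have sgt0 : 0 < s by case: (nat_of_ord s) os.
  have zero : green_ok s (@ord0 n) (p.1 ord0) && green_ok s (@ord0 n) (p.2 ord0).
    by rewrite gr; have /andP[-> _] := bl ord0.
  rewrite w !andbT; apply/and3P; split.
  + by move: zero; rewrite /green_ok sgt0.
  + apply/existsP; exists s.
    have /andP[bs _] := bl s; have gs := gr s.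
    move: bs gs; rewrite /green_ok ltnn eqxx os /= => bs gs.
    rewrite bs gs addn_gt0 bs /=; apply/andP; split; last first.
      by apply/forallP => i; have /andP[_ ->] := bl i.
    apply/forallP => i; have := gr i; have /andP[] := bl i.
    by rewrite /green_ok; case: (ltngtP i s) => [_ /eqP-> _ /eqP->|_|->]; rewrite ?implybT.
  + apply/forallP => i; have := gr i; have /andP[] := bl i.
    rewrite /green_ok; case: (ltngtP i s) => [|| eq_is]; case oi: (odd i) => //=.
    * by move=> _ /eqP-> _ /eqP->.
    * by move=> _ -> _ ->.
    * by move: os; rewrite -eq_is oi.
Qed.

(** Neither size can lie below the other, since both occur. Hence sorting by the smallest part
    counts each partition once. *)
Lemma box_ok_at_uniq N K (p : box N K) (s t : 'I_N.+1) :
  box_ok_at s p -> box_ok_at t p -> s = t.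
Proof.
move=> /andP[_ /forallP ps] /andP[_ /forallP pt]; apply/val_inj.
have := ps s; have := ps t; have := pt s; have := pt t; rewrite /green_ok /=.
by rewrite !ltnn !eqxx; case: (ltngtP s t) => // _ *; lia.
Qed.

Lemma box_ok_at_wt N K (p : box N K) (s : 'I_N.+1) :
  odd s -> box_ok_at s p -> 0 < weight p.
Proof.
move=> os /andP[_ /forallP/(_ s)]; rewrite /green_ok ltnn eqxx /weight.
rewrite (bigD1 s) //= addn_gt0 muln_gt0 addn_gt0 => ->.
by rewrite orbT andbT; case: (nat_of_ord s) os.
Qed.

Lemma box_ok_wt N K (p : box N K) : box_ok p -> 0 < weight p.
Proof. by case/existsP => s /andP[]; apply: box_ok_at_wt. Qed.

(** * Transport of partitions between boxes *)

Definition extend N K (f : {ffun 'I_N.+1 -> 'I_K.+1}) (i : nat) : nat :=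
  if i < N.+1 then nat_of_ord (f (inord i)) else 0.

Lemma extend_ord N K (f : {ffun 'I_N.+1 -> 'I_K.+1}) (i : 'I_N.+1) :
  extend f i = f i.
Proof. by rewrite /extend ltn_ord inord_val. Qed.

Lemma extend_inj N K : injective (@extend N K).
Proof.
move=> f g fg; apply/ffunP => i; apply/val_inj => /=.
by rewrite -!extend_ord fg.
Qed.

Definition rebox1 N K N' K' (f : {ffun 'I_N.+1 -> 'I_K.+1}) :
  {ffun 'I_N'.+1 -> 'I_K'.+1} := [ffun i : 'I_N'.+1 => inord (extend f i)].

Definition rebox N K N' K' (p : box N K) : box N' K' :=
  (rebox1 N' K' p.1, rebox1 N' K' p.2).

(** Under this condition no part is cut off by [rebox], and the [inord] in [rebox1] never falls back
    to its default value. *)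
Definition fits N K N' K' (p : box N K) : Prop :=
  forall i : nat, (extend p.1 i <= K' /\ extend p.2 i <= K') /\
    (N' < i -> extend p.1 i = 0 /\ extend p.2 i = 0).

Lemma extend_rebox N K N' K' (p : box N K) : fits N' K' p ->
  extend (rebox N' K' p).1 = extend p.1 /\ extend (rebox N' K' p).2 = extend p.2.
Proof.
move=> fp; split; apply/funext => i; have [[l1 l2] l3] := fp i.
  rewrite [LHS]/extend; case: ifP => iN; last by case: l3 => [|->//]; lia.
  by rewrite ffunE !inordK.
rewrite [LHS]/extend; case: ifP => iN; last by case: l3 => [|_ ->//]; lia.
by rewrite ffunE !inordK.
Qed.

Lemma reboxK N K N' K' (p : box N K) : fits N' K' p ->
  rebox N K (rebox N' K' p) = p.
Proof.
move=> fp; have [e1 e2] := extend_rebox fp.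
have fp' : fits N K (rebox N' K' p).
  move=> i; rewrite e1 e2 /extend; case: ifP => iN; last by [].
  by have := ltn_ord (p.1 (inord i)); have := ltn_ord (p.2 (inord i)); split; lia.
have [e1' e2'] := extend_rebox fp'.
case: p fp e1 e2 fp' e1' e2' => f g fp e1 e2 fp' e1' e2'.
by congr pair; apply: extend_inj; [rewrite -[RHS]e1 -[RHS]e1'|rewrite -[RHS]e2 -[RHS]e2'].
Qed.

Lemma sum_extend N N' (F : nat -> nat) (P : pred nat) :
  (forall i, N < i -> F i = 0) -> (forall i, N' < i -> F i = 0) ->
  \sum_(i < N.+1 | P i) F i = \sum_(i < N'.+1 | P i) F i.
Proof.
wlog le_NN' : N N' / N <= N'.
  by move=> H h h'; case/orP: (leq_total N N') => ?; [|symmetry]; apply: H.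
move=> h _; rewrite (big_ord_widen_cond N'.+1) //.
rewrite [RHS](bigID (fun i : 'I_N'.+1 => i < N.+1)) /= [X in _ + X]big1 ?addn0 //.
by move=> i /andP[_]; rewrite -leqNgt => /h.
Qed.

Lemma weight_extend N K (p : box N K) :
  weight p = \sum_(i < N.+1) i * (extend p.1 i + extend p.2 i).
Proof. by apply: eq_bigr => i _; rewrite !extend_ord. Qed.

Lemma weight_rebox N K N' K' (p : box N K) : fits N' K' p ->
  weight (rebox N' K' p) = weight p.
Proof.
move=> fp; rewrite !weight_extend; have [-> ->] := extend_rebox fp.
apply: (@sum_extend _ _ (fun i => i * (extend p.1 i + extend p.2 i)) xpredT).
  by move=> i iN; have [_ []] := fp i => // -> ->; rewrite muln0.
by move=> i iN; rewrite /extend ltnNge iN muln0.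
Qed.

Lemma even_parts_rebox N K N' K' (p : box N K) : fits N' K' p ->
  even_parts (rebox N' K' p) = even_parts p.
Proof.
move=> fp; rewrite /even_parts.
under eq_bigr do rewrite -!extend_ord.
under [RHS]eq_bigr do rewrite -!extend_ord.
have [-> ->] := extend_rebox fp.
apply: (@sum_extend _ _ (fun i => extend p.1 i + extend p.2 i) (fun i => ~~ odd i)).
  by move=> i iN; have [_ []] := fp i => // -> ->.
by move=> i iN; rewrite /extend ltnNge iN.
Qed.

(** Stated through [extend] and an unbounded [s], the condition no longer mentions the box; [s > N]
    is impossible because the multiplicity at [s] is positive. *)
Lemma box_okP N K (p : box N K) :
  reflect (exists s : nat, odd s /\
     forall i : nat, blue_ok s i (extend p.1 i) && green_ok s i (extend p.2 i))
   (box_ok p).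
Proof.
apply: (iffP existsP) => [[s /andP[os ok]] | [s [os ok]]].
  case/andP: ok => /forallP bl /forallP gr.
  exists (s : nat); split=> // i.
  case: (ltnP i N.+1) => iN.
    by have := bl (inord i); have := gr (inord i); rewrite /extend iN inordK // => -> ->.
  rewrite /extend ltnNge iN /= /blue_ok /green_ok andbF /= andbT andbb.
  have si : s < i by rewrite (leq_trans (ltn_ord s)).
  by rewrite ltnNge ltnW //= gtn_eqF // orbT.
have sN : s < N.+1.
  rewrite ltnNge; apply/negP => Ns; have /andP[_] := ok s.
  by rewrite /extend ltnNge Ns /green_ok ltnn eqxx.
exists (Ordinal sN); rewrite /= os /= /box_ok_at.
by apply/andP; split; apply/forallP => i; have /andP[] := ok i; rewrite !extend_ord.
Qed.

Lemma box_ok_rebox N K N' K' (p : box N K) : fits N' K' p ->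
  box_ok (rebox N' K' p) = box_ok p.
Proof.
move=> fp; have [e1 e2] := extend_rebox fp.
by apply/idP/idP => /box_okP; rewrite ?e1 ?e2 => h; apply/box_okP; rewrite ?e1 ?e2.
Qed.

(** A part [i > 0] occurring [k > 0] times contributes [i * k] to the weight, which bounds both [i]
    and [k]. The size 0 does not occur, being below an odd smallest part. *)
Lemma fits_weight N K (p : box N K) : box_ok p -> fits (weight p) (weight p) p.
Proof.
case/existsP=> s /andP[os ok]; case/andP: ok => /forallP bl /forallP gr i.
rewrite /extend; case: ifP => iN //.
set j : 'I_N.+1 := inord i; have ji : j = i :> nat by rewrite inordK.
have /andP[b0 _] := bl j; have g0 := gr j.
have : j * (p.1 j + p.2 j) <= weight p by rewrite /weight (bigD1 j) //= leq_addr.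
case: (posnP i) => [i0 _|ipos]; last first.
  rewrite ji => le_w; split.
    have : p.1 j + p.2 j <= i * (p.1 j + p.2 j) by rewrite leq_pmull.
    by lia.
  move=> wi; have : p.1 j + p.2 j = 0; last by lia.
  apply/eqP; rewrite -leqn0 leqNgt; apply/negP => pos.
  have : i <= i * (p.1 j + p.2 j) by rewrite leq_pmulr.
  by lia.
have sgt0 : 0 < s by case: (nat_of_ord s) os.
by move: b0 g0; rewrite ji i0 /green_ok sgt0 => /eqP-> /eqP->.
Qed.

Lemma fits_mono N K a b a' b' (p : box N K) :
  a <= a' -> b <= b' -> fits a b p -> fits a' b' p.
Proof.
move=> la lb fp i; have [[l1 l2] l3] := fp i; split; last by move=> ?; apply: l3; lia.
by split; lia.
Qed.

End Boxes.

(** * Signed generating functions *)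

Section GeneratingFunctions.
Variable F : numFieldType.
Implicit Types eps q r : F.

Definition box_term eps q N K (p : box N K) : F :=
  eps ^+ even_parts p * q ^+ weight p.

Definition part_term eps q (i k : nat) : F :=
  (if odd i then 1 else eps ^+ k) * q ^+ (i * k).

Definition box_sum eps q N K : F :=
  \sum_(p : box N K | box_ok p) box_term eps q p.

Definition level_sum eps N K n : F :=
  \sum_(p : box N K | box_ok p && (weight p == n)) eps ^+ even_parts p.

Definition signed_count eps n : F := level_sum eps n n n.

Definition count_sum eps q L : F := \sum_(1 <= n < L) signed_count eps n * q ^+ n.

Lemma signed_countE eps n :
  signed_count eps n = \sum_(p : two_coloring n | admissible p) eps ^+ nb_even_parts p.
Proof. by apply: eq_bigl => p; rewrite admissible_box_ok. Qed.

Lemma signed_count1 n : signed_count 1 n = (C n)%:R.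
Proof.
rewrite signed_countE; under eq_bigr do rewrite expr1n.
by rewrite sumr_const /C cardsE.
Qed.

Lemma signed_countN1 n : signed_count (-1) n = (C' n)%:~R.
Proof.
rewrite signed_countE /C' /C0 /C1 rmorphB /= -!pmulrn.
rewrite (bigID (fun p => odd (nb_even_parts p))) /= addrC; congr (_ + _).
  under eq_bigr => p /andP[_ ev] do rewrite -signr_odd (negbTE ev) expr0.
  by rewrite sumr_const cardsE.
under eq_bigr => p /andP[_ od] do rewrite -signr_odd od expr1.
by rewrite sumrN sumr_const cardsE.
Qed.

Lemma box_term_prod eps q N K (p : box N K) : box_term eps q p =
  (\prod_(i < N.+1) part_term eps q i (p.1 i)) *
  (\prod_(i < N.+1) part_term eps q i (p.2 i)).
Proof.
rewrite -big_split /= /box_term /part_term /even_parts /weight.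
rewrite -!prodrXr [X in X * _]big_mkcond -big_split /=; apply: eq_bigr => i _.
by case: (odd i) => /=; rewrite mulnDr !exprD; ring.
Qed.

(** The smallest part is unique, so the sum splits over [s]; for fixed [s] the multiplicities are
    independent of each other and the sum factors over colors and sizes. *)
Lemma box_sumE eps q N K : box_sum eps q N K = \sum_(s < N.+1 | odd s)
  (\prod_(i < N.+1) \sum_(k < K.+1 | blue_ok s i k) part_term eps q i k) *
  (\prod_(i < N.+1) \sum_(k < K.+1 | green_ok s i k) part_term eps q i k).
Proof.
transitivity (\sum_(s < N.+1 | odd s)
    \sum_(p : box N K | box_ok_at s p) box_term eps q p).
  rewrite /box_sum big_mkcond /=.
  under [RHS]eq_bigr do rewrite big_mkcond /=.
  rewrite exchange_big /=; apply: eq_bigr => p _; case: ifP => [|nok].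
    rewrite /box_ok => /existsP[s /andP[os ok]].
    rewrite (bigD1 s) //= ok big1 ?addr0 // => t /andP[_ ts]; case: ifP => // okt.
    by rewrite (box_ok_at_uniq okt ok) eqxx in ts.
  rewrite big1 // => s os; case: ifP => // ok.
  by case/negP: (negbT nok); rewrite /box_ok; apply/existsP; exists s; rewrite os.
apply: eq_bigr => s _; rewrite !bigA_distr_big_dep big_distrlr /= pair_big_dep /=.
by apply: eq_big => [p|p _]; rewrite ?box_term_prod.
Qed.

(** Every partition of [n] fits in the box of size [n], hence in any larger one, and [rebox] is a
    bijection between the two. *)
Lemma level_sum_stable eps N K n : (n <= N)%N -> (n <= K)%N ->
  level_sum eps N K n = signed_count eps n.
Proof.
move=> nN nK; rewrite /signed_count /level_sum.
have fit a b (p : box a b) : box_ok p && (weight p == n) -> fits n n p.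
  by move=> /andP[ok /eqP <-]; apply: fits_weight.
have fit' (p : box n n) : box_ok p && (weight p == n) -> fits N K p.
  by move/fit/(fits_mono nN nK).
rewrite (reindex_onto (rebox N K) (rebox n n)) /=; last first.
  by move=> p /fit; apply: reboxK.
have fitb (p : box n n) : fits N K p.
  move=> i; rewrite /extend; case: ifP => iN; last by [].
  by have := ltn_ord (p.1 (inord i)); have := ltn_ord (p.2 (inord i)); split; lia.
apply: eq_big => [p|p _]; last by rewrite even_parts_rebox.
by rewrite box_ok_rebox // weight_rebox // reboxK // eqxx andbT.
Qed.

(** With all signs positive both sides are cardinals, and [rebox] into the box of size [n] is
    injective: a small box can only miss partitions. *)
Lemma level_sum_le N K n : level_sum 1 N K n <= signed_count 1 n.
Proof.
rewrite /signed_count /level_sum.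
under eq_bigr do rewrite expr1n.
under [X in _ <= X]eq_bigr do rewrite expr1n.
rewrite !sumr_const ler_nat.
have fit (p : box N K) : box_ok p && (weight p == n) -> fits n n p.
  by move=> /andP[ok /eqP <-]; apply: fits_weight.
rewrite -(@card_in_image _ _ (rebox n n)) => [|p p' /fit fp /fit fp' e]; last first.
  by rewrite -(reboxK fp) e reboxK.
apply: subset_leq_card; apply/fintype.subsetP => _ /fintype.imageP[p pin ->].
have fp := fit _ pin; rewrite unfold_in /= box_ok_rebox // weight_rebox //.
Qed.

(** The partitions are grouped by weight; the range starts at 1 because an accepted partition has
    positive weight. *)
Lemma sum_levels eps q N K (P : pred nat) L : (forall n, P n -> (n < L)%N) ->
  \sum_(p : box N K | box_ok p && P (weight p)) box_term eps q p =
  \sum_(1 <= n < L | P n) level_sum eps N K n * q ^+ n.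
Proof.
move=> PL; rewrite [LHS]big_mkcond /=.
under [RHS]eq_bigr do rewrite mulr_suml big_mkcond /=.
rewrite exchange_big /=; apply: eq_bigr => p _.
case: ifP => [/andP[ok Pp]|nok].
  have win : weight p \in index_iota 1 L by rewrite mem_index_iota box_ok_wt ?PL.
  rewrite big_mkcond (bigD1_seq (weight p)) ?iota_uniq //= ok eqxx Pp /box_term.
  rewrite big1 ?addr0 // => n nw; case: ifP => // _.
  by rewrite eq_sym (negbTE nw) andbF.
rewrite big1 // => n Pn; case: ifP => // /andP[ok /eqP wn].
by rewrite -wn ok in Pn nok; rewrite Pn in nok.
Qed.

Lemma count_sum_box eps q N K L : (L <= N)%N -> (L <= K)%N ->
  count_sum eps q L = \sum_(p : box N K | box_ok p && (weight p < L)%N) box_term eps q p.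
Proof.
move=> LN LK; rewrite (sum_levels _ _ _ _ (P := fun n => (n < L)%N) (L := L)) //.
rewrite /count_sum big_nat_cond [RHS]big_nat_cond.
apply: eq_big => [n|n /andP[/andP[_ nL] _]]; first by lia.
by rewrite level_sum_stable //; lia.
Qed.

(** Both differences run over the same partitions of the box, those of weight at least [L], so the
    triangle inequality compares them term by term. *)
Lemma box_sum_dist eps q N K L : `|eps| = 1 -> (L <= N)%N -> (L <= K)%N ->
  `|box_sum eps q N K - count_sum eps q L| <=
  box_sum 1 `|q| N K - count_sum 1 `|q| L.
Proof.
move=> e1 LN LK; rewrite !(@count_sum_box _ _ N K L) //.
rewrite /box_sum !(bigID (fun p : box N K => (weight p < L)%N) (@box_ok N K)) /=.
rewrite !(addrC (\sum_(_ | _ && (_ < _)%N) _)) !addrK.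
apply: (le_trans (ler_norm_sum _ _ _)); apply: ler_sum => p _.
by rewrite /box_term normrM !normrX e1 !expr1n.
Qed.

(** A finite box has bounded weights; once [L] exceeds them, each coefficient of the box is at most
    the full one. *)
Lemma box_sum_le r N K : 0 <= r ->
  exists L0 : nat, forall L, (L0 <= L)%N -> box_sum 1 r N K <= count_sum 1 r L.
Proof.
move=> r0; exists (\max_(p : box N K) weight p).+1 => L L0.
have -> : box_sum 1 r N K =
    \sum_(p : box N K | box_ok p && (weight p < L)%N) box_term 1 r p.
  apply: eq_bigl => p; rewrite (leq_ltn_trans _ L0) ?andbT //.
  exact: (leq_bigmax (F := fun p : box N K => weight p)).
rewrite (sum_levels _ _ _ _ (P := fun n => (n < L)%N) (L := L)) // /count_sum.
rewrite [X in X <= _]big_nat_cond [X in _ <= X]big_nat_cond.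
rewrite [X in X <= _](eq_bigl (fun n => (0 < n < L)%N && true)); last by move=> n; lia.
by apply: ler_sum => n _; rewrite ler_wpM2r ?exprn_ge0 ?level_sum_le.
Qed.

End GeneratingFunctions.

(** * Telescoping *)

Section Telescoping.
Variable F : numFieldType.
Variables eps q : F.

Definition odd_prod q m M : F := \prod_(m <= j < M) (1 - q ^+ (2 * j + 1))^-1.

Definition even_prod eps q m M : F := \prod_(m <= j < M) (1 + eps * q ^+ (2 * j + 2)).

(** The start [m + 2] encodes the gap condition: for [s = 2m + 1] the blue even parts begin at
    [s + 5 = 2 (m + 2) + 2]. *)
Definition tail_prod M m : F :=
  odd_prod q m M ^+ 2 * (even_prod eps q m M * even_prod eps q (m + 2) M).

Definition smallest_term M m : F := (q ^+ (2 * m)) ^+ 2 * q ^+ 2 * tail_prod M m.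

(* Factor contributed by the parts equal to [i] of one color when the smallest
   part is [s] and the even parts of that color are at least [t]. *)
Definition part_factor (t s i : nat) : F :=
  if (i < s)%N then 1 else if i == s then q ^+ s * (1 - q ^+ s)^-1
  else if odd i then (1 - q ^+ i)^-1
  else if (t <= i)%N then 1 + eps * q ^+ i else 1.

Definition parts_sum N : F := \sum_(s < N.+1 | odd s)
  (\prod_(i < N.+1) part_factor (s + 5) s i) * (\prod_(i < N.+1) part_factor s s i).

Lemma big_ord_odd (G : nat -> F) M :
  \sum_(s < (2 * M).+1 | odd s) G s = \sum_(0 <= m < M) G (2 * m + 1)%N.
Proof.
elim: M => [|M IH]; first by rewrite big_mkcond muln0 big_ord1 big_nil.
rewrite big_nat_recr //= -IH big_mkcond [in RHS]big_mkcond /=.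
have -> : (2 * M.+1).+1 = (2 * M).+3 by lia.
rewrite !(big_ord_recr (2 * M).+2) !(big_ord_recr (2 * M).+1) /=.
by rewrite oddM /= addr0 addn1.
Qed.

Lemma big_ord_prod_pairs (G : nat -> F) M :
  \prod_(i < (2 * M).+1) G i =
  G 0%N * ((\prod_(0 <= j < M) G (2 * j + 1)%N) * \prod_(0 <= j < M) G (2 * j + 2)%N).
Proof.
elim: M => [|M IH]; first by rewrite muln0 big_ord1 !big_nil !mulr1.
rewrite !big_nat_recr //=.
have -> : (2 * M.+1).+1 = (2 * M).+3 by lia.
rewrite (big_ord_recr (2 * M).+2) (big_ord_recr (2 * M).+1) /= IH addn1 addn2; ring.
Qed.

Lemma big_nat_if (G : nat -> F) m M :
  \prod_(0 <= j < M) (if (m <= j)%N then G j else 1) = \prod_(m <= j < M) G j.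
Proof.
elim: M => [|M IH]; first by rewrite !big_geq.
rewrite big_nat_recr //= IH; case: leqP => [mM|Mm]; first by rewrite big_nat_recr.
by rewrite !big_geq ?mulr1 //; lia.
Qed.

(** [t'] is the index [j] of the first even size [2j + 2] allowed by the threshold [t]: it is
    [m + 2] for blue and [m] for green. *)
Lemma prod_part_factor m t t' M : (m < M)%N ->
  (forall j, (t <= 2 * j + 2)%N = (t' <= j)%N) -> (m <= t')%N ->
  \prod_(i < (2 * M).+1) part_factor t (2 * m + 1) i =
  q ^+ (2 * m + 1) * (odd_prod q m M * even_prod eps q t' M).
Proof.
move=> mM tt' mt'; rewrite big_ord_prod_pairs.
have -> : part_factor t (2 * m + 1) 0 = 1 by rewrite /part_factor addn1.
rewrite mul1r mulrA; congr (_ * _); last first.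
  rewrite /even_prod -[RHS]big_nat_if; apply: eq_bigr => j _; rewrite /part_factor.
  rewrite tt' oddD oddM /=; case: (leqP t' j) => t'j.
    by rewrite ifF ?ifF //; lia.
  by case: ifP => // _; case: eqP => //; lia.
rewrite (big_cat_nat (leq0n m) (ltnW mM)) //= big_nat big1 ?mul1r; last first.
  by move=> j jm; rewrite /part_factor ifT //; lia.
rewrite /odd_prod big_ltn // [in RHS]big_ltn // mulrA; congr (_ * _).
  by rewrite /part_factor ltnn eqxx.
apply: eq_big_nat => j jm; rewrite /part_factor.
have -> : (2 * j + 1 < 2 * m + 1)%N = false by lia.
have -> : (2 * j + 1 == 2 * m + 1)%N = false by lia.
by rewrite oddD oddM.
Qed.

Lemma parts_sumE M : parts_sum (2 * M) = \sum_(0 <= m < M) smallest_term M m.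
Proof.
rewrite /parts_sum (big_ord_odd (fun s =>
  (\prod_(i < (2 * M).+1) part_factor (s + 5) s i) *
  (\prod_(i < (2 * M).+1) part_factor s s i))).
apply: eq_big_nat => m /andP[_ mM].
rewrite (@prod_part_factor m _ (m + 2)) ?(@prod_part_factor m _ m) //; try by move=> *; lia.
rewrite /smallest_term /tail_prod exprD expr1; ring.
Qed.

(** * Gosper summation over the smallest part *)

Hypothesis q1 : `|q| < 1.
Hypothesis eps2 : eps = 1 \/ eps = -1.

(** Solution of Gosper's equation by a linear polynomial in [x]: its terms of degree 0 and 3 cancel
    for any such polynomial, as [eps ^+ 2 = 1]. Degree 1 fixes the ratio of the two coefficients and
    degree 2 their scale. *)
Definition multiplier_num x : F :=
  - q ^+ 2 * ((1 - eps * q) - eps * x * (1 + eps * q - q ^+ 2 + eps * q ^+ 3)).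

Definition multiplier x : F :=
  multiplier_num x / ((1 + eps * q) * (1 + eps * q ^+ 3) ^+ 2).

(** At [m.+1], the two leading factors turn [tail_prod M m.+1] into [(1 - x q)^2 * tail_prod M m]
    with [x = q^(2m)]. The difference of consecutive values is then Gosper's equation times
    [tail_prod M m]. *)
Definition antidiff M m : F := let x := q ^+ (2 * m) in
  (1 + eps * x) * (1 + eps * x * q ^+ 4) * multiplier x * tail_prod M m.

Lemma norm_exp_lt1 n : (0 < n)%N -> `|q ^+ n| < 1.
Proof. by move=> n0; rewrite normrX exprn_ilt1 // -lt0n. Qed.

Lemma one_sub_neq0 (z : F) : `|z| < 1 -> 1 - z != 0.
Proof.
move=> z1; apply/eqP => /eqP; rewrite subr_eq0 => /eqP z1'.
by rewrite -z1' normr1 ltxx in z1.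
Qed.

Lemma one_addM_neq0 (z : F) : `|z| < 1 -> 1 + eps * z != 0.
Proof.
move=> z1; rewrite -[eps * z]opprK one_sub_neq0 // normrN normrM.
by case: eps2 => ->; rewrite ?normrN normr1 mul1r.
Qed.

Lemma multiplier_identity x :
  (1 + eps * x * q ^+ 4) * (1 + eps * x) * multiplier x -
    (1 - x * q) ^+ 2 * multiplier (x * q ^+ 2) = x ^+ 2 * q ^+ 2.
Proof.
have n1 : 1 + eps * q != 0 by apply: one_addM_neq0.
have n3 : 1 + eps * q ^+ 3 != 0 by apply/one_addM_neq0/norm_exp_lt1.
move: n1 n3; rewrite /multiplier /multiplier_num.
by case: eps2 => ->; rewrite ?mul1r ?mulN1r => n1 n3; field; apply/andP; split.
Qed.

Lemma odd_prod_recl m M : (m < M)%N ->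
  odd_prod q m M = (1 - q ^+ (2 * m) * q)^-1 * odd_prod q m.+1 M.
Proof. by move=> mM; rewrite /odd_prod big_ltn // exprD expr1. Qed.

Lemma even_prod_recl m M : (m < M)%N ->
  even_prod eps q m M = (1 + eps * (q ^+ (2 * m) * q ^+ 2)) * even_prod eps q m.+1 M.
Proof. by move=> mM; rewrite /even_prod big_ltn // exprD. Qed.

Lemma odd_factor_neq0 m k : odd k -> 1 - q ^+ (2 * m) * q ^+ k != 0.
Proof.
by move=> ok; rewrite -exprD one_sub_neq0 // norm_exp_lt1 //; case: k ok => // k _; lia.
Qed.

Lemma smallest_term_telescope M m : (m + 3 <= M)%N ->
  smallest_term M m = antidiff M m - antidiff M m.+1.
Proof.
move=> mM; rewrite /smallest_term /antidiff /tail_prod.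
(* The bound on [m] makes even the product starting at [m + 2] nonempty, so each product gives up
   its first factor. *)
rewrite !(@odd_prod_recl m) ?(@even_prod_recl m) ?(@even_prod_recl (m + 2)); try by lia.
rewrite [(m.+1 + 2)%N]addSn.
have -> : (2 * (m + 2) = 2 * m + 4)%N by lia.
have -> : (2 * m.+1 = 2 * m + 2)%N by lia.
rewrite !(exprD q (2 * m)).
have := @odd_factor_neq0 m 1%N isT; rewrite expr1.
have := multiplier_identity (q ^+ (2 * m)).
set x := q ^+ (2 * m); set D := odd_prod _ _ _; set E := even_prod _ _ _ M.
set E' := even_prod _ _ _ M => idx n1.
rewrite -idx; field; exact: n1.
Qed.

(* [x = q^(2k)] and [M = k + 2]: telescoping stops at [m = k], beyond which the
   product over blue even parts is empty; the last two terms are kept as is. *)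
Definition boundary x : F :=
  (x ^+ 2 * q ^+ 2 - (1 + eps * x) * (1 + eps * x * q ^+ 4) * multiplier x) *
   ((1 - x * q)^-1 ^+ 2 * (1 - x * q ^+ 3)^-1 ^+ 2 *
     ((1 + eps * (x * q ^+ 2)) * (1 + eps * (x * q ^+ 4)))) +
  x ^+ 2 * q ^+ 6 * ((1 - x * q ^+ 3)^-1 ^+ 2 * (1 + eps * (x * q ^+ 4))).

Lemma sum_smallest_term k :
  \sum_(0 <= m < k.+2) smallest_term k.+2 m =
  (1 + eps) * multiplier 1 *
    (odd_prod q 0 k.+2 ^+ 2 * (even_prod eps q 0 k.+2 * even_prod eps q 1 k.+2)) +
  boundary (q ^+ (2 * k)).
Proof.
rewrite !big_nat_recr //= (@telescope_sumr_eq _ 0 k (fun m => - antidiff k.+2 m)) //; last first.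
  by move=> m mk; rewrite smallest_term_telescope ?opprK 1?addrC //; lia.
(* At [x = 1] the factor [1 + eps q^4] completes the product starting at 2 to the one starting at
   1. *)
have -> : antidiff k.+2 0 = (1 + eps) * multiplier 1 *
    (odd_prod q 0 k.+2 ^+ 2 * (even_prod eps q 0 k.+2 * even_prod eps q 1 k.+2)).
  rewrite /antidiff /tail_prod /= muln0 expr0 (@even_prod_recl 1) // add0n.
  rewrite muln1 mulr1; move: (odd_prod _ _ _) (even_prod _ _ 0 _) (even_prod _ _ 2 _).
  by move: (multiplier 1) => a b c d; ring.
rewrite /antidiff /smallest_term /tail_prod /boundary.
rewrite !(@odd_prod_recl k) ?(@odd_prod_recl k.+1) ?(@even_prod_recl k) ?(@even_prod_recl k.+1) //.
rewrite /odd_prod /even_prod !(big_geq (m := k.+2)) // !(big_geq (m := _ + 2)); try by lia.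
have -> : (2 * k.+1 = 2 * k + 2)%N by lia.
rewrite !(exprD q (2 * k)).
set x := q ^+ (2 * k); have -> : x * q ^+ 2 * q = x * q ^+ 3 by ring.
ring.
Qed.

End Telescoping.

(** * Convergence of complex sequences *)

Section ComplexSequences.
Local Open Scope classical_set_scope.
Local Open Scope complex_scope.
Variable R : realType.
Implicit Types (u v : nat -> R[i]) (a b l z : R[i]).

Definition ctends u l : Prop := (u : nat -> R[i]^o) @ \oo --> (l : R[i]^o).

(** A positive element of [R[i]] is real, so real tolerances suffice. *)
Lemma ctendsP u l : ctends u l <->
  (forall e : R, 0 < e -> exists N, forall n, (N <= n)%N -> `|l - u n| < e%:C).
Proof.
split=> [/(@cvgrPdist_lt R[i] R[i]^o) h e e0|h].
  have [|N _ hN] := h e%:C; first by rewrite ltcR.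
  by exists N.
apply/(@cvgrPdist_lt R[i] R[i]^o) => e e0.
have re : e = (complex.Re e)%:C by rewrite RRe_real // gtr0_real.
have [|N hN] := h (complex.Re e); first by rewrite -ltcR -re.
by exists N => // n /= Nn; rewrite re; apply: hN.
Qed.

Lemma ctends_lim u l : ctends u l -> limn (u : nat -> R[i]^o) = l.
Proof. by move=> ul; apply: (@cvg_lim R[i]^o) => //. Qed.

Lemma ctends_cvgn u l : ctends u l -> cvgn (u : nat -> R[i]^o).
Proof. by move=> ul; apply: cvgP ul. Qed.

Lemma ctends_unique u a b : ctends u a -> ctends u b -> a = b.
Proof. by move=> ua ub; rewrite -(ctends_lim ua) -(ctends_lim ub). Qed.

Lemma ctends_ext u v l : u =1 v -> ctends u l -> ctends v l.
Proof. by move=> /funext ->. Qed.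

Lemma ctends_cst a : ctends (fun=> a) a.
Proof. exact: cvg_cst. Qed.

Lemma ctendsD u v a b : ctends u a -> ctends v b -> ctends (fun n => u n + v n) (a + b).
Proof. by move=> ua vb; exact: cvgD ua vb. Qed.

Lemma ctendsB u v a b : ctends u a -> ctends v b -> ctends (fun n => u n - v n) (a - b).
Proof. by move=> ua vb; exact: cvgB ua vb. Qed.

Lemma ctendsM u v a b : ctends u a -> ctends v b -> ctends (fun n => u n * v n) (a * b).
Proof. by move=> ua vb; exact: cvgM ua vb. Qed.

Lemma ctendsV u a : a != 0 -> ctends u a -> ctends (fun n => (u n)^-1) a^-1.
Proof. by move=> a0 ua; exact: cvgV a0 ua. Qed.

Lemma ctendsX u a k : ctends u a -> ctends (fun n => u n ^+ k) (a ^+ k).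
Proof.
move=> ua; elim: k => [|k IH]; first exact: ctends_cst.
by under eq_fun do rewrite exprS; rewrite exprS; apply: ctendsM.
Qed.

Lemma ctends_sum (I : Type) (s : seq I) (P : pred I) (f : I -> nat -> R[i]) (g : I -> R[i]) :
  (forall i, P i -> ctends (f i) (g i)) ->
  ctends (fun n => \sum_(i <- s | P i) f i n) (\sum_(i <- s | P i) g i).
Proof.
move=> fg; elim: s => [|i s IH].
  by under eq_fun do rewrite big_nil; rewrite big_nil; apply: ctends_cst.
under eq_fun do rewrite big_cons; rewrite big_cons.
by case: ifP => [Pi|_]; [exact: ctendsD (fg i Pi) IH | exact: IH].
Qed.

Lemma ctends_prod (I : Type) (s : seq I) (f : I -> nat -> R[i]) (g : I -> R[i]) :
  (forall i, ctends (f i) (g i)) ->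
  ctends (fun n => \prod_(i <- s) f i n) (\prod_(i <- s) g i).
Proof.
move=> fg; elim: s => [|i s IH].
  by under eq_fun do rewrite big_nil; rewrite big_nil; apply: ctends_cst.
under eq_fun do rewrite big_cons; rewrite big_cons; exact: ctendsM (fg i) IH.
Qed.

Lemma ctends_shift m u l : ctends (fun n => u (n + m)%N) l <-> ctends u l.
Proof.
split=> /ctendsP h; apply/ctendsP => e /h[N hN].
  by exists (N + m)%N => n Nn; rewrite -(@subnK m n) ?hN //; lia.
by exists N => n Nn; apply: hN; lia.
Qed.

(** The hypothesis forces each [v n] to be a nonnegative real, although [v] is complex-valued. *)
Lemma ctends_le u v l : (forall n, `|l - u n| <= v n) -> ctends v 0 -> ctends u l.
Proof.
move=> uv /ctendsP v0; apply/ctendsP => e /v0[N hN]; exists N => n /hN.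
rewrite sub0r normrN; apply: le_lt_trans; apply: (le_trans (uv n)).
by rewrite real_ler_norm // ger0_real // (le_trans _ (uv n)).
Qed.

Lemma ctends_real (v : nat -> R) (l : R) : v @ \oo --> l ->
  ctends (fun n => (v n)%:C) l%:C.
Proof.
move=> /cvgrPdist_lt h; apply/ctendsP => e e0; have [N _ hN] := h e e0.
exists N => n Nn; rewrite -rmorphB /= normc_def /= expr0n /= addr0 sqrtr_sqr ltcR.
exact: hN.
Qed.

Lemma norm_realE z : exists2 t : R, 0 <= t & `|z| = t%:C.
Proof.
exists (complex.Re `|z|); first by rewrite -ler0c RRe_real // normr_real.
by rewrite RRe_real // normr_real.
Qed.

Lemma ctends_expr z : `|z| < 1 -> ctends (fun n => z ^+ n) 0.
Proof.
have [t t0 zt] := norm_realE z; rewrite zt -[1]/(1%:C) ltcR => t1.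
apply: (@ctends_le _ (fun n => (t ^+ n)%:C)).
  by move=> n; rewrite sub0r normrN normrX zt rmorphXn.
by apply: ctends_real; apply: cvg_expr; rewrite ger0_norm.
Qed.

(** Each of the [n + 1] copies of [s^n] is at most a term [s^i] of the geometric sum. *)
Lemma natS_expr_bound (s : R) n : 0 <= s -> s < 1 ->
  n.+1%:R * s ^+ n <= (1 - s)^-1.
Proof.
move=> s0 s1; rewrite -[leRHS]mul1r ler_pdivlMr ?subr_gt0 //.
apply: (@le_trans _ _ (1 - s ^+ n.+1)); last by rewrite lerBlDr lerDl exprn_ge0.
rewrite -[leRHS]opprB subrX1 -mulNr opprB mulrC ler_wpM2l ?subr_ge0 ?(ltW s1) //.
have -> : n.+1%:R * s ^+ n = \sum_(i < n.+1) s ^+ n.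
  by rewrite sumr_const card_ord mulr_natl.
apply: ler_sum => i _.
by apply: ler_wiXn2l; [exact: s0 | exact: ltW | have := ltn_ord i; lia].
Qed.

(** With [s] the square root of the modulus, [n s^(2n) = (n s^n) s^n], where the first factor is
    bounded and the second tends to 0. *)
Lemma ctends_natM_expr z : `|z| < 1 -> ctends (fun n => n%:R * z ^+ n) 0.
Proof.
have [t t0 zt] := norm_realE z; rewrite zt -[1]/(1%:C) ltcR => t1.
set s := Num.sqrt t; have s0 : 0 <= s by apply: sqrtr_ge0.
have s2 : s ^+ 2 = t by rewrite sqr_sqrtr.
have s1 : s < 1 by rewrite -(@ltr_pXn2r _ 2) ?nnegrE // s2 expr1n.
apply: (@ctends_le _ (fun n => ((1 - s)^-1 * s ^+ n)%:C)).
  move=> n; rewrite sub0r normrN normrM normrX zt normr_nat -s2.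
  rewrite -(rmorph_nat (real_complex R)) -rmorphXn -rmorphM lecR -exprM.
  rewrite mul2n -addnn exprD mulrA ler_wpM2r ?exprn_ge0 //.
  apply: le_trans (natS_expr_bound n s0 s1).
  by rewrite ler_wpM2r ?exprn_ge0 // ler_nat.
rewrite -[0](mulr0 ((1 - s)^-1)%:C).
apply: (@ctends_ext (fun n => ((1 - s)^-1)%:C * (s ^+ n)%:C)).
  by move=> n; rewrite rmorphM.
apply: ctendsM; first exact: ctends_cst.
by apply: ctends_real; apply: cvg_expr; rewrite ger0_norm.
Qed.

(* [R[i]] has no completeness instance; for the real and imaginary parts [v],
   [v + p] is nondecreasing and bounded. *)
Lemma ctends_bounded_variation u (p : nat -> R) (B : R) :
  (forall n, `|u n.+1 - u n| <= (p n.+1 - p n)%:C) -> (forall n, p n <= B) ->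
  exists l, ctends u l.
Proof.
move=> up pB.
have real_case (v : nat -> R) : (forall n, `|v n.+1 - v n| <= p n.+1 - p n) ->
    exists l : R, v @ \oo --> l.
  move=> vp.
  have p_incr : {homo p : n m / (n <= m)%N >-> n <= m}.
    apply: homo_leq => [//|x y z xy yz|n]; first exact: le_trans xy yz.
    by rewrite -subr_ge0 (le_trans _ (vp n)).
  have vB n : v n <= v 0%N + (p n - p 0%N).
    elim: n => [|n IH]; first by rewrite subrr addr0.
    have := le_trans (ler_norm _) (vp n); lra.
  have cp : cvgn p.
    apply: nondecreasing_is_cvgn => //; exists B => _ [n _ <-]; exact: pB.
  have cvp : cvgn (v \+ p).
    apply: nondecreasing_is_cvgn.
      apply: homo_leq => [//|x y z xy yz|n]; first exact: le_trans xy yz.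
      by have := vp n; rewrite ler_norml /= => /andP[]; lra.
    exists (v 0%N + (B - p 0%N) + B) => _ [n _ <-] /=.
    by have := vB n; have := pB n; lra.
  exists (limn (v \+ p) - limn p).
  have e : (v \+ p - p)%R = v by apply/funext => n; exact: addrK.
  by have := cvgB cvp cp; rewrite e; apply.
have [|lr hr] := real_case (fun n => complex.Re (u n)).
  by move=> n; rewrite -lecR -raddfB; apply: le_trans (up n); apply: normc_ge_Re.
have [|li hi] := real_case (fun n => complex.Im (u n)).
  (* Up to sign, the imaginary part is the real part after multiplication by ['i]. *)
  move=> n; rewrite -lecR -raddfB -normrN -ReiNIm; apply: le_trans (up n).
  by apply: (le_trans (normc_ge_Re _)); rewrite normrM complexiE normCi mulr1.
exists (lr%:C + 'i%C * li%:C).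
apply: (@ctends_ext (fun n => (complex.Re (u n))%:C + 'i%C * (complex.Im (u n))%:C)).
  by move=> n; rewrite -complexE.
by apply: ctendsD; [|apply: ctendsM; first exact: ctends_cst]; apply: ctends_real.
Qed.

(** The increments are dominated by those of [p n], the product of the [1 + c j], and
    [1 + c <= expR c] bounds [p] by [expR B]. *)
Lemma ctends_infinite_prod u (c : nat -> R) (B : R) :
  (forall j, `|u j| <= (c j)%:C) -> (forall N, \sum_(0 <= j < N) c j <= B) ->
  exists l, ctends (fun N => \prod_(0 <= j < N) (1 + u j)) l.
Proof.
move=> uc cB.
have c0 j : 0 <= c j by rewrite -ler0c (le_trans _ (uc j)).
pose p n := \prod_(0 <= j < n) (1 + c j).
have pB n : p n <= expR B.
  apply: (@le_trans _ _ (expR (\sum_(0 <= j < n) c j))); last by rewrite ler_expR.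
  rewrite expR_sum; apply: ler_prod => j _.
  by rewrite expR_ge1Dx addr_ge0.
apply: (@ctends_bounded_variation _ p _ _ pB) => n.
have Pp : `|\prod_(0 <= j < n) (1 + u j)| <= (p n)%:C.
  rewrite normr_prod rmorph_prod; apply: ler_prod => j _; rewrite normr_ge0 /=.
  by rewrite rmorphD; apply: (le_trans (ler_normD _ _)); rewrite normr1 lerD2l.
rewrite /p !big_nat_recr //= -/(p n) !mulrDr !mulr1 [X in `|X|]addrC addKr.
by rewrite [X in (X)%:C]addrC addKr normrM rmorphM ler_pM.
Qed.

Lemma sum_expr_bound (t : R) N : 0 <= t -> t < 1 -> \sum_(0 <= j < N) t ^+ j <= (1 - t)^-1.
Proof.
move=> t0 t1; rewrite -[leRHS]mul1r ler_pdivlMr ?subr_gt0 //.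
apply: (@le_trans _ _ (1 - t ^+ N)); last by rewrite lerBlDr lerDl exprn_ge0.
by rewrite -[leRHS]opprB subrX1 -mulNr opprB mulrC big_mkord.
Qed.

End ComplexSequences.

(** * Limits of the generating functions *)

Section Limits.
Local Open Scope complex_scope.
Variable R : realType.
Implicit Types (q z eps : R[i]).

Lemma ctends_geometric z : `|z| < 1 ->
  ctends (fun K => \sum_(k < K) z ^+ k) (1 - z)^-1.
Proof.
move=> z1; have z0 : 1 - z != 0 by apply: one_sub_neq0.
apply: (@ctends_ext _ (fun K => (1 - z ^+ K) * (1 - z)^-1)).
  by move=> K; rewrite -[1 - z ^+ K]opprB subrX1 -mulNr opprB mulrAC divff ?mul1r.
rewrite -[X in ctends _ X]mul1r -[X in ctends _ (X * _)]subr0.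
apply: ctendsM; last exact: ctends_cst.
by apply: ctendsB; [exact: ctends_cst | apply: ctends_expr].
Qed.

Lemma ctends_part_factor eps q t s i : `|q| < 1 -> odd s ->
  ctends (fun K => \sum_(k < K.+1 | green_ok s i k &&
                        (~~ odd i && (0 < k) ==> (t <= i))%N) part_term eps q i k)
    (part_factor eps q t s i).
Proof.
move=> q1 os; have s0 : (0 < s)%N by case: (s) os.
rewrite /part_factor /green_ok /part_term.
case: (ltngtP i s) => [lt_is|lt_si|->].
- rewrite /=; apply: (ctends_ext _ (@ctends_cst R 1)) => K.
  rewrite big_mkcond big_ord_recl /= andbF /= muln0 expr0 mulr1 if_same big1 ?addr0 //.
- have qi : `|q ^+ i| < 1 by rewrite norm_exp_lt1 //; lia.
  case: ifP => /= oi.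
    apply: (ctends_ext _ ((ctends_shift 1 _ _).2 (ctends_geometric qi))) => K.
    by rewrite addn1; apply: eq_bigr => k _; rewrite mul1r exprM.
  (* A larger even size has multiplicity 0 or 1, so the sum is constant from [K = 1] on; [K = 0] is
     skipped by the shift. *)
  apply/(@ctends_shift _ 1); apply: (ctends_ext _ (@ctends_cst R _)) => K.
  rewrite addn1 big_mkcond !big_ord_recl /= muln0 muln1 !expr0 mulr1 expr1 big1 ?addr0 //.
  by case: ifP => //= ti; rewrite addr0.
- rewrite os /=; have qs : `|q ^+ s| < 1 by rewrite norm_exp_lt1.
  apply: (ctends_ext _ (ctendsM (@ctends_cst R (q ^+ s)) (ctends_geometric qs))) => K.
  rewrite [RHS]big_mkcond big_ord_recl /= add0r mulr_sumr; apply: eq_bigr => k _.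
  by rewrite mul1r /= mulnS exprD exprM.
Qed.

Lemma ctends_box_sum eps q N : `|q| < 1 ->
  ctends (box_sum eps q N) (parts_sum eps q N).
Proof.
move=> q1; apply: (@ctends_ext _ (fun K => \sum_(s < N.+1 | odd s)
  (\prod_(i < N.+1) \sum_(k < K.+1 | blue_ok s i k) part_term eps q i k) *
  (\prod_(i < N.+1) \sum_(k < K.+1 | green_ok s i k) part_term eps q i k))).
  by move=> K; rewrite box_sumE.
apply: ctends_sum => s os; apply: ctendsM; apply: ctends_prod => i.
  exact: ctends_part_factor.
(* For green parts the threshold [s] adds no constraint: [green_ok] already excludes sizes below
   [s]. *)
apply: (ctends_ext _ (@ctends_part_factor eps q s s i q1 os)) => K.
apply: eq_bigl => k; rewrite /green_ok.
case: (ltngtP i s) => [lt_is|lt_si|->]; rewrite ?implybT ?andbT // ?os ?andbT //.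
by case: (nat_of_ord k) => [|k'] //=; rewrite ?andbF.
Qed.

Lemma ctends_qpoch a q : `|q| < 1 ->
  ctends (fun N => \prod_(0 <= j < N) (1 - a * q ^+ j)) (qpoch a q).
Proof.
move=> q1; suff [l hl] : exists l, ctends (fun N => \prod_(0 <= j < N) (1 - a * q ^+ j)) l.
  by rewrite (_ : qpoch a q = l) //; apply: ctends_lim hl.
have [t t0 qt] := norm_realE q; have [b b0 ab] := norm_realE a.
have t1 : t < 1 by rewrite -ltcR -qt.
apply: (@ctends_infinite_prod _ (fun j => - (a * q ^+ j)) (fun j => b * t ^+ j) (b * (1 - t)^-1)).
  by move=> j; rewrite normrN normrM normrX qt ab rmorphM rmorphXn.
by move=> N; rewrite -mulr_sumr ler_wpM2l // sum_expr_bound.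
Qed.

Lemma odd_prodE q N :
  odd_prod q 0 N = (\prod_(0 <= j < N) (1 - q * (q ^+ 2) ^+ j))^-1.
Proof.
rewrite /odd_prod prodfV; congr _^-1; apply: eq_bigr => j _.
by rewrite exprD exprM expr1 mulrC.
Qed.

(* The product of the inverse factors converges as well. *)
Lemma qpoch_neq0 q : `|q| < 1 -> qpoch q (q ^+ 2) != 0.
Proof.
move=> q1; have q21 : `|q ^+ 2| < 1 by apply: norm_exp_lt1.
have [t t0 qt] := norm_realE q; have t1 : t < 1 by rewrite -ltcR -qt.
have nz j : 1 - q ^+ (2 * j + 1) != 0.
  by rewrite one_sub_neq0 // norm_exp_lt1 // addn1.
have [l hl] : exists l, ctends (odd_prod q 0) l.
  (* Each inverse factor is [1 + z / (1 - z)] with [z = q^(2j+1)], where the modulus of [1 - z] is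
     at least [1 - t]. *)
  have [||l hl] := @ctends_infinite_prod _
    (fun j => q ^+ (2 * j + 1) / (1 - q ^+ (2 * j + 1)))
    (fun j => (1 - t)^-1 * t ^+ j) ((1 - t)^-1 * (1 - t)^-1); last first.
  - exists l; apply: (ctends_ext _ hl) => N; apply: eq_bigr => j _.
    by have := nz j; move: (q ^+ _) => z z1; field.
  - by move=> N; rewrite -mulr_sumr ler_wpM2l ?invr_ge0 ?subr_ge0 ?(ltW t1) // sum_expr_bound.
  move=> j; rewrite mulrC normrM normfV normrX qt rmorphM fmorphV rmorphXn.
  have le1 m : (1 <= m)%N -> t ^+ m <= t.
    by move=> m1; rewrite -[leRHS]expr1; apply: ler_wiXn2l => //; apply: ltW.
  have tc : (0 : R[i]) < (1 - t)%:C by rewrite ltcR subr_gt0.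
  apply: ler_pM => //; rewrite ?invr_ge0 ?exprn_ge0 ?ler0c //.
    rewrite lef_pV2 ?posrE ?normr_gt0 //.
    rewrite rmorphB; apply: le_trans (lerB_dist _ _); rewrite normr1 lerD2l lerN2.
    by rewrite normrX qt -rmorphXn lecR le1 // addn1.
  by rewrite -!rmorphXn lecR; apply: ler_wiXn2l; [exact: t0 | exact: ltW | lia].
(* The two partial products multiply to 1, yet their product would tend to 0. *)
apply/eqP => p0; have := ctendsM hl (@ctends_qpoch q _ q21).
rewrite p0 mulr0 => h; suff : (1 : R[i]) = 0 by move/eqP; rewrite oner_eq0.
apply: ctends_unique (@ctends_cst R 1) _; apply: (ctends_ext _ h) => N.
rewrite odd_prodE mulVf // prodf_seq_neq0; apply/allP => j _.
by have := nz j; rewrite exprD exprM expr1 mulrC.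
Qed.

Lemma ctends_odd_prod q : `|q| < 1 -> ctends (odd_prod q 0) (qpoch q (q ^+ 2))^-1.
Proof.
move=> q1; apply: (@ctends_ext _ (fun N => (\prod_(0 <= j < N) (1 - q * (q ^+ 2) ^+ j))^-1)).
  by move=> N; rewrite odd_prodE.
by apply: ctendsV; [apply: qpoch_neq0 | apply/ctends_qpoch/norm_exp_lt1].
Qed.

Lemma ctends_even_prod0 eps q : `|q| < 1 ->
  ctends (even_prod eps q 0) (qpoch (- eps * q ^+ 2) (q ^+ 2)).
Proof.
move=> q1; have q21 : `|q ^+ 2| < 1 by apply: norm_exp_lt1.
apply: (ctends_ext _ (@ctends_qpoch (- eps * q ^+ 2) _ q21)) => N.
by apply: eq_bigr => j _; rewrite exprD exprM; ring.
Qed.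

Lemma ctends_even_prod1 eps q : `|q| < 1 ->
  ctends (even_prod eps q 1) (qpoch (- eps * q ^+ 4) (q ^+ 2)).
Proof.
move=> q1; have q21 : `|q ^+ 2| < 1 by apply: norm_exp_lt1.
apply/(@ctends_shift _ 1).
apply: (ctends_ext _ (@ctends_qpoch (- eps * q ^+ 4) _ q21)) => N.
rewrite /even_prod big_add1 addn1 /=; apply: eq_bigr => j _.
have -> : (2 * j.+1 + 2 = 2 * j + 4)%N by lia.
by rewrite exprD exprM; ring.
Qed.

Definition count_limit eps q : R[i] :=
  (1 + eps) * multiplier eps q 1 *
    ((qpoch q (q ^+ 2))^-1 ^+ 2 *
     (qpoch (- eps * q ^+ 2) (q ^+ 2) * qpoch (- eps * q ^+ 4) (q ^+ 2))) +
  - multiplier eps q 0.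

(** [boundary] is rational in [x] without a pole at 0, and [x = q^(2k)] tends to 0, so the limit is
    its value at 0. *)
Lemma ctends_boundary eps q : `|q| < 1 ->
  ctends (fun k => boundary eps q (q ^+ (2 * k))) (- multiplier eps q 0).
Proof.
move=> q1; have q21 : `|q ^+ 2| < 1 by apply: norm_exp_lt1.
have hx : ctends (fun k => q ^+ (2 * k)) 0.
  by apply: (ctends_ext _ (ctends_expr q21)) => k; rewrite exprM.
have -> : - multiplier eps q 0 = boundary eps q 0.
  by rewrite /boundary !(mulr0, mul0r, expr0n, subr0, addr0, invr1, expr1n, mulr1, mul1r, sub0r).
have c := @ctends_cst R.
have fac z n : ctends (fun k => 1 + z * (q ^+ (2 * k) * q ^+ n)) (1 + z * (0 * q ^+ n)).
  by apply: ctendsD (c _) (ctendsM (c _) (ctendsM hx (c _))).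
have fac' n : ctends (fun k => (1 - q ^+ (2 * k) * q ^+ n)^-1 ^+ 2) ((1 - 0 * q ^+ n)^-1 ^+ 2).
  apply: ctendsX; apply: ctendsV; first by rewrite mul0r subr0 oner_neq0.
  by apply: ctendsB (c _) (ctendsM hx (c _)).
have hcof : ctends (fun k => multiplier eps q (q ^+ (2 * k))) (multiplier eps q 0).
  rewrite /multiplier /multiplier_num; apply: ctendsM; last exact: c.
  apply: ctendsM; first exact: c.
  apply: ctendsB; first exact: c.
  by apply: ctendsM; [apply: ctendsM; first exact: c | exact: c].
have h1 := ctendsM (c eps) hx.
apply: ctendsD; apply: ctendsM.
- apply: ctendsB; first by apply: ctendsM (ctendsX hx) (c _).
  apply: ctendsM; last exact: hcof.
  apply: ctendsM; first exact: ctendsD (c _) h1.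
  by apply: ctendsD (c _) (ctendsM h1 (c _)).
- by apply: ctendsM (ctendsM (fac' 1%N) (fac' 3%N)) (ctendsM (fac _ _) (fac _ _)).
- by apply: ctendsM (ctendsX hx) (c _).
- by apply: ctendsM (fac' 3%N) (fac _ _).
Qed.

Lemma ctends_parts_sum eps q : `|q| < 1 -> eps = 1 \/ eps = -1 ->
  ctends (fun k => parts_sum eps q (2 * k.+2)) (count_limit eps q).
Proof.
move=> q1 e2; pose G n := (1 + eps) * multiplier eps q 1 *
    (odd_prod q 0 n ^+ 2 * (even_prod eps q 0 n * even_prod eps q 1 n)).
apply: (@ctends_ext _ (fun k => G (k + 2)%N + boundary eps q (q ^+ (2 * k)))).
  by move=> k; rewrite parts_sumE sum_smallest_term // /G addn2.
apply: ctendsD; last exact: ctends_boundary.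
apply/(@ctends_shift _ 2 G); apply: ctendsM; first exact: ctends_cst.
apply: ctendsM; first by apply/ctendsX/ctends_odd_prod.
by apply: ctendsM; [apply: ctends_even_prod0 | apply: ctends_even_prod1].
Qed.

(** [S] is compared with a box sum [B] close to [L]. The error is at most [B' - S'], the same
    difference at the modulus of [q] with positive signs. A fixed box sum [B0'] close to [L']
    satisfies [B0' <= S'], which leaves [B' - B0'], a difference of two approximations of [L']. *)
Lemma ctends_count_sum eps q : `|q| < 1 -> eps = 1 \/ eps = -1 ->
  ctends (count_sum eps q) (count_limit eps q).
Proof.
move=> q1 e2; have r1 : `| `|q| | < 1 by rewrite normr_id.
have eps1 : `|eps| = 1 by case: e2 => ->; rewrite ?normrN normr1.
have A := ctends_parts_sum q1 e2.
have /ctendsP A' := ctends_parts_sum r1 (or_introl (erefl (1 : R[i]))).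
move/ctendsP in A; apply/ctendsP => e e0.
(* Six errors are added: two from [L] to [B], and four from [B'] to [B0'] through [L']. *)
have d0 : 0 < e / 6 by lra.
have [N1 h1] := A _ d0; have [k0 h2] := A' _ d0.
have [K0 h3] := (ctendsP _ _).1 (@ctends_box_sum 1 `|q| (2 * k0.+2) r1) _ d0.
have [L0 h4] := @box_sum_le _ `|q| (2 * k0.+2) K0 (normr_ge0 q).
exists (N1 + k0 + L0)%N => k hk.
have [K1 h5] := (ctendsP _ _).1 (@ctends_box_sum eps q (2 * k.+2) q1) _ d0.
have [K2 h6] := (ctendsP _ _).1 (@ctends_box_sum 1 `|q| (2 * k.+2) r1) _ d0.
(* [K] may depend on [k], whereas [k0], [K0] and [L0] were fixed before [k]. *)
pose K := (K1 + K2 + k)%N.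
have [[kN1 kk0] kL0] : (N1 <= k /\ k0 <= k)%N /\ (L0 <= k)%N by clear -hk; lia.
have [[KK1 KK2] kK] : (K1 <= K /\ K2 <= K)%N /\ (k <= K)%N by clear; lia.
have k2 : (k <= 2 * k.+2)%N by clear; lia.
have dist := @box_sum_dist _ eps q (2 * k.+2) K k eps1 k2 kK.
have {}h1 := h1 k kN1; have h2' := h2 k kk0.
have {}h2 := h2 k0 (leqnn _); have {}h3 := h3 K0 (leqnn _).
have {}h4 := h4 k kL0; have {}h5 := h5 K KK1; have {}h6 := h6 K KK2.
move: h1 h2 h2' h3 h4 h5 h6 dist.
set L := count_limit _ _; set L' := count_limit _ _.
set Ak := parts_sum eps _ _; set Ak' := parts_sum 1 _ (2 * k.+2).
set A0' := parts_sum 1 _ _; set B0' := box_sum 1 _ _ K0.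
set B := box_sum eps _ _ _; set B' := box_sum 1 _ _ K.
set S := count_sum eps _ _; set S' := count_sum 1 _ _.
move=> h1 h2 h2' h3 h4 h5 h6 dist.
have dist' : `|B - S| <= B' - B0' by apply: le_trans dist _; rewrite lerD2l lerN2.
have tri : B' - B0' <= `|Ak' - B'| + (`|L' - Ak'| + (`|L' - A0'| + `|A0' - B0'|)).
  rewrite -[B' - B0']ger0_norm ?(le_trans _ dist') //.
  have -> : B' - B0' = - (Ak' - B') + (- (L' - Ak') + ((L' - A0') + (A0' - B0'))) by ring.
  apply: le_trans (ler_normD _ _) _; rewrite normrN lerD2l.
  apply: le_trans (ler_normD _ _) _; rewrite normrN lerD2l.
  exact: ler_normD.
have -> : L - S = (L - Ak) + ((Ak - B) + (B - S)) by ring.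
have -> : e%:C = (e / 6)%:C + ((e / 6)%:C + ((e / 6)%:C +
    ((e / 6)%:C + ((e / 6)%:C + (e / 6)%:C)))).
  by rewrite -!rmorphD; congr (_%:C); field.
apply: le_lt_trans (ler_normD _ _) (ltrD h1 _).
apply: le_lt_trans (ler_normD _ _) (ltrD h5 _).
exact: le_lt_trans (le_trans dist' tri) (ltrD h6 (ltrD h2' (ltrD h2 h3))).
Qed.

End Limits.

(** * The theorem *)

Section QuadraticSeries.
Variable R : realType.
Implicit Types q : R[i].

Definition quadratic_term q (n : nat) : R[i] :=
  (n%:R + 1) * (n%:R + n%:R * q + (n%:R + 1) * q ^+ 2) * q ^+ (3 * n).

Lemma ctends_quadratic_series q : `|q| < 1 ->
  ctends (partial_sums 0 (quadratic_term q))
    (q ^+ 2 * (1 + q) / ((1 - q) * (1 - q ^+ 3) ^+ 2)).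
Proof.
move=> q1; set c := _ / _; set z := q ^+ 3.
have z1 : `|z| < 1 by apply: norm_exp_lt1.
have qn : 1 - q != 0 by apply: one_sub_neq0.
have zn : 1 - z != 0 by apply: one_sub_neq0.
(* [U N] is the remainder after [N] terms, sought as [(a N^2 + b N + c) z^N]; comparing powers of
   [N] in [U N - U N.+1] with the general term gives [a] and [b]. *)
pose a := (1 - q)^-1; pose b := (1 + q + 2 * q ^+ 2 + 2 * z * a) / (1 - z).
pose U n : R[i] := a * (n%:R ^+ 2 * z ^+ n) + b * (n%:R * z ^+ n) + c * z ^+ n.
apply: (@ctends_ext _ (fun N => c - U N)).
  move=> N; rewrite /partial_sums; elim: N => [|N IH].
    by rewrite big_nil /U !(mul0r, expr0n, mulr0, add0r, expr0, mulr1) subrr.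
  rewrite big_nat_recr //= -IH /U /quadratic_term exprM -/z (exprS z N).
  rewrite -[N.+1%:R]natr1.
  move: (z ^+ N) (N%:R : R[i]) zn => y n.
  by rewrite /b /a /c /z => zn; field; rewrite qn zn.
have hU : ctends U 0; last by have := ctendsB (@ctends_cst R c) hU; rewrite subr0.
(* With [w] a square root of [z], [n^2 z^n = (n w^n)^2]. *)
have w1 : `|sqrtC z| < 1.
  by rewrite -(@ltr_pXn2r _ 2) ?nnegrE // -normrX sqrtCK expr1n.
have -> : 0 = a * 0 ^+ 2 + b * 0 + c * 0 :> R[i] by rewrite expr0n !mulr0 !addr0.
have cst := @ctends_cst R.
apply: ctendsD; first apply: ctendsD.
- apply: ctendsM; first exact: cst.
  apply: (ctends_ext _ (@ctendsX R _ _ 2 (ctends_natM_expr w1))) => m.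
  by rewrite exprMn -exprM mulnC exprM sqrtCK.
- by apply: ctendsM; [exact: cst | apply: ctends_natM_expr].
- by apply: ctendsM; [exact: cst | apply: ctends_expr].
Qed.

End QuadraticSeries.

Theorem theorem7 (R : realType) (q : R[i]) (hq : `|q| < 1) :
  (let F := 2 * q ^+ 3 * (2 - q + q ^+ 2) / ((1 + q) * (1 + q ^+ 3) ^+ 2)
            * (qpoch2 (- q ^+ 2) (- q ^+ 4) (q ^+ 2) / qpoch q (q ^+ 2) ^+ 2) in
   let c := fun n : nat => (C n)%:R * q ^+ n in
   let d := fun n : nat =>
     (-1) ^+ n * (n%:R + 1) * (n%:R - n%:R * q + (n%:R + 1) * q ^+ 2)
     * q ^+ (3 * n) in
   [/\ summable_from 1 c,
       infsum 1 c = F + q ^+ 2 * (1 - q) / ((1 + q) * (1 + q ^+ 3) ^+ 2),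
       summable_from 0 d
     & F + q ^+ 2 * (1 - q) / ((1 + q) * (1 + q ^+ 3) ^+ 2)
       = F + infsum 0 d])
  /\
  (let c' := fun n : nat => (C' n)%:~R * q ^+ n in
   let e := fun n : nat =>
     (n%:R + 1) * (n%:R + n%:R * q + (n%:R + 1) * q ^+ 2) * q ^+ (3 * n) in
   [/\ summable_from 1 c',
       infsum 1 c' = q ^+ 2 * (1 + q) / ((1 - q) * (1 - q ^+ 3) ^+ 2),
       summable_from 0 e
     & q ^+ 2 * (1 + q) / ((1 - q) * (1 - q ^+ 3) ^+ 2) = infsum 0 e]).
Proof.
have hNq : `|- q| < 1 by rewrite normrN.
split=> [F c d|c' e].
- have hc : ctends (partial_sums 1 c)
      (F + q ^+ 2 * (1 - q) / ((1 + q) * (1 + q ^+ 3) ^+ 2)).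
    (* For [eps = 1], twice the numerator of [multiplier] at 1 is [2 q^3 (2 - q + q^2)], and the
       rational summand is minus its value at 0. *)
    have -> : F + q ^+ 2 * (1 - q) / ((1 + q) * (1 + q ^+ 3) ^+ 2) = count_limit 1 q.
      rewrite /count_limit /F /qpoch2 /multiplier /multiplier_num !mulN1r !mul1r.
      rewrite exprVn; move: (qpoch _ _ ^+ 2)^-1 (qpoch _ _) (qpoch _ _) => x y z.
      move: (_ ^-1) => w; ring.
    apply: (ctends_ext _ (ctends_count_sum hq (or_introl erefl))) => N.
    by apply: eq_bigr => n _; rewrite signed_count1.
  have hd : ctends (partial_sums 0 d) (q ^+ 2 * (1 - q) / ((1 + q) * (1 + q ^+ 3) ^+ 2)).
    (* The series of (a) is that of (b) at [- q], since [(-1)^(3n) = (-1)^n]. *)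
    have -> : q ^+ 2 * (1 - q) / ((1 + q) * (1 + q ^+ 3) ^+ 2) =
        (- q) ^+ 2 * (1 + - q) / ((1 - - q) * (1 - (- q) ^+ 3) ^+ 2).
      by rewrite sqrrN opprK [(- q) ^+ 3]exprNn -signr_odd expr1 mulN1r opprK.
    apply: (ctends_ext _ (ctends_quadratic_series hNq)) => N.
    apply: eq_bigr => n _; rewrite /quadratic_term /d sqrrN [(- q) ^+ _]exprNn.
    by rewrite -signr_odd oddM /= signr_odd; ring.
  split; first exact: ctends_cvgn hc.
  + exact: ctends_lim hc.
  + exact: ctends_cvgn hd.
  + by rewrite /infsum (ctends_lim hd).
- have hc' : ctends (partial_sums 1 c') (q ^+ 2 * (1 + q) / ((1 - q) * (1 - q ^+ 3) ^+ 2)).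
    have -> : q ^+ 2 * (1 + q) / ((1 - q) * (1 - q ^+ 3) ^+ 2) = count_limit (-1) q.
      rewrite /count_limit subrr !mul0r add0r /multiplier /multiplier_num mulr0 mul0r.
      by rewrite subr0 !mulN1r opprK mulNr mulNr opprK.
    apply: (ctends_ext _ (ctends_count_sum hq (or_intror erefl))) => N.
    by apply: eq_bigr => n _; rewrite signed_countN1.
  have he : ctends (partial_sums 0 e) (q ^+ 2 * (1 + q) / ((1 - q) * (1 - q ^+ 3) ^+ 2)).
    exact: ctends_quadratic_series.
  split; first exact: ctends_cvgn hc'.
  + exact: ctends_lim hc'.
  + exact: ctends_cvgn he.
  + by rewrite /infsum (ctends_lim he).
Qed.
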